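(* Let $m$, $n$ and $q$ be positive odd integers. Then \[ \sum_{k = 1}^\infty \frac{1}{\prod_{j=0}^{m-1} F_{nk+njq}\,\prod_{j=m+1}^{2m} F_{nk+njq}} = \frac{1}{L_{mnq}}\sum_{k=1}^{q}\frac{1}{\prod_{j=0}^{2m-1}F_{nk+njq}}. \]
   Context: The Fibonacci numbers are defined by $F_0=0$, $F_1=1$, $F_n=F_{n-1}+F_{n-2}$, and the Lucas numbers by $L_0=2$, $L_1=1$, $L_n=L_{n-1}+L_{n-2}$. Infinite sums are limits of partial sums. *)

(* Defs.v *)
From mathcomp Require Import all_boot all_order all_algebra.
From mathcomp Require Import all_classical all_reals all_analysis.

Set Implicit Arguments.
Unset Strict Implicit.
Unset Printing Implicit Defensive.

Fixpoint fib (n : nat) : nat :=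
  match n with
  | 0 => 0
  | 1 => 1
  | (p.+1 as p').+1 => fib p' + fib p
  end.

Fixpoint lucas (n : nat) : nat :=
  match n with
  | 0 => 2
  | 1 => 1
  | (p.+1 as p').+1 => lucas p' + lucas p
  end.

(* Main.v *)
Require Import Defs.
From mathcomp Require Import all_boot all_order all_algebra.
From mathcomp Require Import all_classical all_reals all_analysis.
From mathcomp Require Import zify ring.
Import Order.TTheory GRing.Theory Num.Theory.
Import numFieldNormedType.Exports.
Local Open Scope classical_set_scope.
Local Open Scope ring_scope.

(** Put [P k = 1 / \prod_(0 <= j < 2m) F_(nk + njq)] and [d = mnq].  Shifting
    [k] by [q] shifts [j] by one, so [P k - P (k + q)] has numerator
    [F_(nk + 2d) - F_(nk)], which equals [L_d F_(nk + d)] because [d] is odd.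
    The factor [F_(nk + d)] cancels the [j = m] term of the product, so the
    [k]-th term of the series is [(P k - P (k + q)) / L_d].  The series
    telescopes with step [q], and [P k <= 2 / k] kills the tail. *)

Lemma fibSS x : fib x.+2 = (fib x.+1 + fib x)%N.
Proof. by []. Qed.

Lemma lucasSS x : lucas x.+2 = (lucas x.+1 + lucas x)%N.
Proof. by []. Qed.

Lemma fib_gt0 x : (0 < x)%N -> (0 < fib x)%N.
Proof.
case: x => // x _; elim: x => // x IH.
by rewrite fibSS addn_gt0 IH.
Qed.

(** A crude linear bound is enough here: it makes the tail of the series comparable with [1 / k].
    Equality at [x = 2] forces the factor 2. *)
Lemma leq_double_fib x : (x <= 2 * fib x)%N.
Proof.
suff: (x <= 2 * fib x)%N /\ (x.+1 <= 2 * fib x.+1)%N by case.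
(* The bound at 2 is checked by computation, since adding the bounds at 0 and 1 gives only 1. *)
elim: x => // -[//|x] [IH1 IH2]; split => //.
by rewrite fibSS; lia.
Qed.

Lemma fibD x y : fib (x + y).+1 = (fib x.+1 * fib y.+1 + fib x * fib y)%N.
Proof.
elim: x y => [|x IH] y; first by rewrite /= mul1n mul0n addn0.
by rewrite addSnnS IH !fibSS; ring.
Qed.

Lemma lucasS_fib x : lucas x.+1 = (fib x.+2 + fib x)%N.
Proof.
suff: lucas x.+1 = (fib x.+2 + fib x)%N /\
      lucas x.+2 = (fib x.+3 + fib x.+1)%N by case.
elim: x => // x [IH1 IH2]; split => //.
by rewrite lucasSS IH1 IH2 !fibSS; lia.
Qed.

Lemma lucas_gt0 x : (0 < lucas x)%N.
Proof. by case: x => // x; rewrite lucasS_fib addn_gt0 fib_gt0. Qed.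

Lemma fib_cassini (R : comNzRingType) x :
  (-1) ^+ x.+1 = (fib x)%:R * (fib x.+2)%:R - (fib x.+1)%:R ^+ 2 :> R.
Proof.
elim: x => [|x IH]; first by rewrite /= expr1; ring.
by rewrite exprS IH !fibSS !natrD; ring.
Qed.

(** For fixed [d] both sides satisfy the Fibonacci recurrence in [x], so agreement at [x = 0] and
    [x = 1] suffices. The addition formula [fibD] settles the first, and Cassini's identity supplies
    the sign in the second. *)
Lemma fib_lucas_shift (R : comNzRingType) x d :
  (fib (x + 2 * d))%:R =
  (lucas d)%:R * (fib (x + d))%:R - (-1) ^+ d * (fib x)%:R :> R.
Proof.
case: d => [|d]; first by rewrite muln0 !addn0 expr0 /=; ring.
pose E y := (fib (y + 2 * d.+1))%:R =
  (lucas d.+1)%:R * (fib (y + d.+1))%:R - (-1) ^+ d.+1 * (fib y)%:R :> R.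
suff: E x /\ E x.+1 by case.
elim: x => [|x [IH1 IH2]].
  rewrite /E; split.
    have -> : (0 + 2 * d.+1 = (d.+1 + d).+1)%N by lia.
    by rewrite fibD lucasS_fib add0n !natrD !natrM /=; ring.
  have -> : (1 + 2 * d.+1 = (d.+1 + d.+1).+1)%N by lia.
  by rewrite fibD lucasS_fib add1n fib_cassini [in LHS]natrD !natrM natrD mulr1; ring.
split => //; rewrite /E in IH1 IH2 *.
by rewrite !addSn !fibSS -!addSn !natrD IH1 IH2; ring.
Qed.

Lemma fib_odd_lucas_shift (R : comNzRingType) x d : odd d ->
  (fib (x + 2 * d))%:R - (fib x)%:R = (lucas d)%:R * (fib (x + d))%:R :> R.
Proof. by move=> hd; rewrite fib_lucas_shift -signr_odd hd expr1; ring. Qed.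

Lemma sum_telescope_step (V : zmodType) (u : nat -> V) q N :
  \sum_(1 <= k < N.+1) (u k - u (k + q)%N) =
  \sum_(1 <= k < q.+1) u k - \sum_(i < q) u (N.+1 + i)%N.
Proof.
have shift_sum (a b : nat) : \sum_(a <= k < a + b) u k = \sum_(i < b) u (a + i)%N.
  rewrite -{1}[a]add0n big_addn addKn big_mkord.
  by apply: eq_bigr => i _; rewrite addnC.
have shift_q : \sum_(1 <= k < N.+1) u (k + q)%N = \sum_(q.+1 <= k < q.+1 + N) u k.
  rewrite shift_sum big_add1 big_mkord; apply: eq_bigr => i _.
  by rewrite !addSn addnC.
(* Once the subtracted sums change sides, both sides are the sum of [u] over [1..N+q], cut after [N]
   on one side and after [q] on the other. *)
rewrite sumrB shift_q -shift_sum; apply/eqP.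
rewrite subr_eq addrAC eq_sym subr_eq eq_sym; apply/eqP.
rewrite -!big_cat_nat ?leq_addr //.
by congr bigop; congr index_iota; lia.
Qed.

(** The common denominator is the product of [a 0] through [a M]: the first fraction lacks [a M],
    the second [a 0]. The factor [a m] is set apart for a later cancellation. *)
Lemma inv_prod_shift_sub (F : fieldType) (a : nat -> F) m M :
  (m <= M)%N -> (forall j, a j != 0) ->
  1 / \prod_(0 <= j < M) a j - 1 / \prod_(1 <= j < M.+1) a j =
  (a M - a 0) /
  (a m * (\prod_(0 <= j < m) a j * \prod_(m.+1 <= j < M.+1) a j)).
Proof.
move=> leqmM a0.
have prod0 i j : \prod_(i <= l < j) a l != 0.
  by rewrite prodf_seq_neq0; apply/allP => l _; exact: a0.
have splitE : \prod_(0 <= j < M.+1) a j =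
    a m * (\prod_(0 <= j < m) a j * \prod_(m.+1 <= j < M.+1) a j).
  rewrite (@big_cat_nat _ _ _ m) //=; last exact: leqW.
  by rewrite (@big_ltn _ _ _ m) // mulrCA.
have lastE : \prod_(0 <= j < M.+1) a j = \prod_(0 <= j < M) a j * a M.
  exact: big_nat_recr.
have firstE : \prod_(0 <= j < M.+1) a j = a 0 * \prod_(1 <= j < M.+1) a j.
  exact: big_ltn.
rewrite -splitE mulrBl {1}lastE firstE; move: (prod0 0 M) (prod0 1 M.+1).
set C := \prod_(0 <= j < M) _; set D := \prod_(1 <= j < _) _ => C0 D0.
by field; rewrite C0 D0 !a0.
Qed.

Section FibProduct.
Variables (R : realType) (m n q : nat).

(** The [P k] of the overview, which is also the summand on the right-hand side of the theorem. *)
Definition inv_fib_prod k : R :=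
  1 / \prod_(0 <= j < 2 * m) (fib (n * k + n * j * q))%:R.

Hypotheses (m_gt0 : (0 < m)%N) (n_gt0 : (0 < n)%N).

Lemma fib_factor_ge1 k j : (0 < k)%N ->
  1 <= (fib (n * k + n * j * q))%:R :> R.
Proof. by move=> k0; rewrite ler1n fib_gt0 // addn_gt0 muln_gt0 n_gt0 k0. Qed.

Lemma fib_factor_gt0 k j : (0 < k)%N ->
  0 < (fib (n * k + n * j * q))%:R :> R.
Proof. by move=> k0; exact: lt_le_trans ltr01 (fib_factor_ge1 _ j k0). Qed.

Lemma inv_fib_prod_ge0 k : 0 <= inv_fib_prod k.
Proof. by rewrite divr_ge0 // prodr_ge0. Qed.

(** The factor at [j = 0] is at least [k / 2], and all the others are at least 1. *)
Lemma inv_fib_prod_le k : (0 < k)%N -> inv_fib_prod k <= 2 / k%:R.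
Proof.
move=> k0; rewrite /inv_fib_prod ler_pdivrMr; last first.
  by apply: prodr_gt0 => j _; exact: fib_factor_gt0.
rewrite mulrAC ler_pdivlMr ?ltr0n // mul1r.
have -> : (2 * m = (2 * m).-1.+1)%N by lia.
rewrite big_nat_recl // muln0 mul0n addn0 mulrA.
have le_k : k%:R <= 2 * (fib (n * k))%:R :> R.
  rewrite -natrM ler_nat; apply: leq_trans (leq_double_fib _).
  by rewrite leq_pmull.
rewrite -[leLHS]mulr1; apply: ler_pM => //.
apply: (big_ind (fun x : R => 1 <= x)) => // [x y|j _].
  exact: mulr_ege1.
exact: fib_factor_ge1.
Qed.

Lemma inv_fib_prod_diff k : odd (m * n * q) -> (0 < k)%N ->
  1 / (\prod_(0 <= j < m) (fib (n * k + n * j * q))%:R *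
       \prod_(m.+1 <= j < (2 * m).+1) (fib (n * k + n * j * q))%:R) =
  1 / (lucas (m * n * q))%:R * (inv_fib_prod k - inv_fib_prod (k + q)).
Proof.
move=> hd k0; set a := fun j => (fib (n * k + n * j * q))%:R : R.
have a0 j : a j != 0 by rewrite gt_eqF // fib_factor_gt0.
have L0 : (lucas (m * n * q))%:R != 0 :> R by rewrite pnatr_eq0 -lt0n lucas_gt0.
(* Replacing [k] by [k + q] turns the factor of index [j] into that of index [j + 1]. *)
have -> : inv_fib_prod (k + q) = 1 / \prod_(1 <= j < (2 * m).+1) a j.
  rewrite /inv_fib_prod big_add1 /=; congr (1 / _).
  by apply: eq_bigr => j _; rewrite /a; congr (fib _)%:R; lia.
rewrite /inv_fib_prod -/a.
have shift : a (2 * m)%N - a 0%N = (lucas (m * n * q))%:R * a m.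
  have := fib_odd_lucas_shift R (n * k) _ hd; rewrite /a.
  have -> : (n * (2 * m) * q = 2 * (m * n * q))%N by lia.
  have -> : (n * m * q = m * n * q)%N by lia.
  by rewrite muln0 mul0n addn0.
rewrite (inv_prod_shift_sub R a m) ?shift //; last by lia.
by rewrite !div1r -mulrA mulKf // [in RHS]invfM mulVKf.
Qed.

Lemma inv_fib_prod_tail_cvg0 :
  (\sum_(i < q) inv_fib_prod (N.+1 + i)) @[N --> \oo] --> (0 : R).
Proof.
have bound N : 0 <= \sum_(i < q) inv_fib_prod (N.+1 + i) <=
    (2 *+ q) * harmonic N.
  rewrite sumr_ge0 => [|i _]; last exact: inv_fib_prod_ge0.
  (* Each of the [q] terms is at most [2 / (N + 1)], and [harmonic N] is [1 / (N + 1)]. *)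
  rewrite mulrnAl -[X in _ *+ X]card_ord -sumr_const; apply: ler_sum => i _.
  apply: le_trans (inv_fib_prod_le _ _) _; first by rewrite addSn.
  by rewrite ler_pM2l // lef_pV2 ?posrE ?ltr0n // ler_nat leq_addr.
apply: (@squeeze_cvgr _ _ _ _ (fun=> 0) (fun N => (2 *+ q) * harmonic N)).
- by apply: nearW => N; exact: bound.
- exact: cvg_cst.
- rewrite -[X in _ --> X](mulr0 (2 *+ q : R)).
  by apply: cvgMr; exact: cvg_harmonic.
Qed.

End FibProduct.

Theorem theorem2p6 (R : realType) (m n q : nat)
    (hm : odd m) (hn : odd n) (hq : odd q) :
  (\sum_(1 <= k < N.+1)
     1 / (\prod_(0 <= j < m) (fib (n * k + n * j * q))%:R *
          \prod_(m.+1 <= j < (2 * m).+1) (fib (n * k + n * j * q))%:R)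
     : R) @[N --> \oo]
  --> (1 / (lucas (m * n * q))%:R *
       \sum_(1 <= k < q.+1)
         1 / \prod_(0 <= j < 2 * m) (fib (n * k + n * j * q))%:R : R).
Proof.
have m0 := odd_gt0 hm; have n0 := odd_gt0 hn.
have hd : odd (m * n * q) by rewrite !oddM hm hn hq.
under eq_fun => N.
  (* The summation range provides [0 < k], which keeps every Fibonacci factor nonzero. *)
  rewrite (eq_big_nat _ _ (F2 := fun k => 1 / (lucas (m * n * q))%:R *
    (inv_fib_prod R m n q k - inv_fib_prod R m n q (k + q)))); last first.
    by move=> k /andP[k0 _]; exact: inv_fib_prod_diff.
  rewrite -mulr_sumr sum_telescope_step.
  over.
(* The sum of the first [q] terms does not depend on [N]; only the window of [q] terms after [N]
   moves, and it tends to 0. *)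
apply: cvgMr; rewrite -[X in _ --> X]subr0.
by apply: cvgB; [exact: cvg_cst|exact: inv_fib_prod_tail_cvg0].
Qed.
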